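(* Let $n\ge2$, let $\sigma\in\mathcal{S}_n$ be a cycle of length $n$, and let $k,l$ be integers such that $1\le k\le l<n$, $k\mid n$, $k\mid l$, and there exists an integer $s$ with $1\le s<n$, $\gcd(s,n)=1$ and $l=s\odot k$. Then the number of $\xi\in\mathcal{S}_n$ satisfying $\sigma^k\xi=\xi\sigma^l$ equals $$\mathrm{p}(n,k)=k!\left(\frac{n}{k}\right)^k.$$
   Context: $\mathcal{S}_n$ is the symmetric group on $[n]=\{1,\dots,n\}$, with products composed left to right: $(\alpha\beta)(i)=\beta(\alpha(i))$. For $x,y\in[n]$, $x\odot y$ denotes the element of $[n]$ congruent to $xy$ modulo $n$. *)

(* Defs.v *)
From mathcomp Require Import all_boot all_fingroup.

Set Implicit Arguments.
Unset Strict Implicit.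
Unset Printing Implicit Defensive.

(* The set [n] = {1, ..., n} is modelled by 'I_n = {0, ..., n-1}.  The product
   of 'S_n composes left to right: (a * b)%g i = b (a i), by permM. *)

Definition is_cycle_of_length (T : finType) (m : nat) (s : {perm T}) : Prop :=
  exists x : T, #|porbit s x| = m /\ perm_on (porbit s x) s.

(* The residue is taken in {1, ..., n}, so multiples of n are sent to n. *)
Definition odot (n x y : nat) : nat :=
  if n %| x * y then n else (x * y) %% n.

(* The division is exact where this is used, under k %| n. *)
Definition pnum (n k : nat) : nat := k`! * (n %/ k) ^ k.

(* Main.v *)
(** Both [sigma ^+ k] and [sigma ^+ l] split the [n] points into [k] cycles of
    length [n %/ k]: coprimality of [s] and [n] makes [j |-> s j] a bijection of
    the residues modulo [n %/ k].  A solution [xi] carries the cycles of the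
    first permutation to those of the second, so it amounts to a bijection
    between the cycles together with a shift for each cycle. *)

Require Import Defs.
From mathcomp Require Import all_boot all_fingroup.

Set Implicit Arguments.
Unset Strict Implicit.
Unset Printing Implicit Defensive.

(* [E i j] is the [j]-th point, counted modulo [m], of the cycle with index
   [i].  Surjectivity of [E] is not included: it follows by counting as soon as
   [#|T| = #|I| * m]. *)
Definition cycle_chart (T I : finType) (m : nat) (a : {perm T})
    (E : I -> nat -> T) : Prop :=
  (forall i j, a (E i j) = E i j.+1) /\
  (forall i j i' j', E i j = E i' j' <-> i = i' /\ j = j' %[mod m]).

Section Charts.

Variables (T I : finType) (m : nat).
Implicit Types (a b xi : {perm T}) (E : I -> nat -> T).
Hypothesis cardT : #|T| = #|I| * m.

Lemma cycle_chart_surj a E :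
  cycle_chart m a E -> forall x, exists p : I * 'I_m, E p.1 p.2 = x.
Proof.
move=> [_ injE] x; pose e (p : I * 'I_m) := E p.1 p.2.
have inj_e : injective e.
  move=> [i j] [i' j'] /injE /= [-> eqj]; congr pair; apply: val_inj.
  by move: eqj; rewrite !modn_small.
have : #|T| <= #|{: I * 'I_m}| by rewrite card_prod card_ord cardT.
move/(inj_card_onto inj_e)/(_ x)/codomP => [p ->].
by exists p.
Qed.

(** Each step of [a] along a cycle becomes a step of [b], so a solution is determined on a whole
    cycle by the image of its base point [E i 0]. *)
Lemma cycle_chart_intertwine a b E E' xi i j i' j' :
    cycle_chart m a E -> cycle_chart m b E' -> (a * xi = xi * b)%g ->
  xi (E i 0) = E' i' j' -> xi (E i j) = E' i' (j' + j).
Proof.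
move=> [aE _] [bE _] com xiE; elim: j => [|j IHj]; first by rewrite addn0.
by rewrite -aE -permM com permM IHj bE addnS.
Qed.

(** Conversely, the bijection [q] of cycles and the shifts [f] may be prescribed freely: define the
    map through chosen coordinates [c]. *)
Lemma cycle_chart_glue a b E E' (q : {perm I}) (f : I -> nat) :
    cycle_chart m a E -> cycle_chart m b E' ->
  exists xi, forall i j, xi (E i j) = E' (q i) (f i + j).
Proof.
move=> chartE [_ injE'].
have /fin_all_exists [c cE] := cycle_chart_surj chartE.
have [_ injE] := chartE.
pose g x := E' (q (c x).1) (f (c x).1 + (c x).2).
have inj_g : injective g.
  move=> x y /injE' [/perm_inj eqi /eqP]; rewrite eqi eqn_modDl => /eqP eqj.
  by rewrite -(cE x) -(cE y); apply/injE; split.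
exists (perm inj_g) => i j; rewrite permE /g.
(* The chosen coordinates of [E i j] agree with [j] only modulo [m], which is all that [E'] depends
   on. *)
have /injE [-> eqj] := cE (E i j).
by apply/injE'; split=> //; apply/eqP; rewrite eqn_modDl eqj.
Qed.

Theorem card_intertwining a b E E' :
    cycle_chart m a E -> cycle_chart m b E' ->
  #|[set xi : {perm T} | (a * xi == xi * b)%g]| = #|I|`! * m ^ #|I|.
Proof.
move=> chartE chartE'; have [aE injE] := chartE; have [bE injE'] := chartE'.
have /fin_all_exists [G GE] (w : {perm I} * {ffun I -> 'I_m}) :=
  cycle_chart_glue w.1 (fun i => w.2 i : nat) chartE chartE'.
have injG : injective G.
  move=> [q f] [q' f'] eqG.
  have eqqf i : q i = q' i /\ f i = f' i.
    have := GE (q, f) i 0; rewrite eqG GE /= !addn0 => /injE' [-> eqf].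
    by split=> //; apply: val_inj; move: eqf; rewrite !modn_small.
  by congr pair; [apply/permP | apply/ffunP] => i; case: (eqqf i).
suff -> : [set xi : {perm T} | (a * xi == xi * b)%g] = G @: [set: _].
  rewrite card_imset // cardsT card_prod card_ffun card_ord.
  (* [card_perm] counts the permutations supported in a given set, here the full one. *)
  rewrite -[X in X`!]cardsT -(card_perm [set: I]); congr (_ * _).
  by apply: eq_card => q; rewrite !inE; apply/esym/subsetP.
have surjE' := cycle_chart_surj chartE'.
apply/setP=> xi; rewrite inE; apply/eqP/imsetP => [com | [w _ ->]].
  have /fin_all_exists [p pE] (i : I) := surjE' (xi (E i 0)).
  have xiE i j := cycle_chart_intertwine j chartE chartE' com (esym (pE i)).
  have inj_q : injective (fun i => (p i).1).
    (* This [j] makes [(p i).2 + j] congruent to [(p i').2] modulo [m]. *)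
    move=> i i' /= eqi; pose j := (p i').2 + (m - (p i).2).
    have : xi (E i j) = xi (E i' 0).
      rewrite -(pE i') xiE eqi; apply/injE'; split=> //.
      by rewrite addnCA subnKC ?modnDr // ltnW.
    by move/perm_inj/injE => [].
  exists (perm inj_q, [ffun i => (p i).2]) => //; apply/permP => x.
  have [[i j] <-] := cycle_chart_surj chartE x.
  by rewrite xiE GE /= permE ffunE.
apply/permP => x; have [[i j] <-] := cycle_chart_surj chartE x.
by rewrite !permM aE !GE bE addnS.
Qed.

End Charts.

(** The trajectory of [x] returns after [n] steps and has no repetition before. *)
Lemma expg_porbit_eq (T : finType) (s : {perm T}) x u v :
  (s ^+ u)%g x = (s ^+ v)%g x <-> u = v %[mod #|porbit s x|].
Proof.
set n := #|porbit s x|.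
have n_gt0 : 0 < n by apply/card_gt0P; exists x; apply: porbit_id.
have sM w : (s ^+ w)%g x = nth x (traject s x n) (w %% n).
  rewrite nth_traject ?ltn_mod // {1}(divn_eq w n) addnC permX iterD.
  congr (iter _ _ _); elim: (w %/ n) => //= d IHd.
  by rewrite mulSn iterD IHd iter_porbit.
rewrite !sM; split=> [/eqP | -> //].
by rewrite nth_uniq ?size_traject ?ltn_mod ?uniq_traject_porbit // => /eqP.
Qed.

(** The exponent [i + l * j] determines [i] modulo [k], then [j] modulo [n %/ k]. Taking [s = 1]
    covers [sigma ^+ k] as well. *)
Lemma cycle_chart_expg (T : finType) (sigma : {perm T}) x n k l s :
    #|porbit sigma x| = n -> 0 < k -> k %| n -> coprime s n ->
    l = s * k %[mod n] ->
  cycle_chart (n %/ k) (sigma ^+ l)%g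
    (fun (i : 'I_k) j => (sigma ^+ (i + l * j))%g x).
Proof.
move=> cardx k_gt0 k_n co_sn eql; split=> [i j | i j i' j'].
  by rewrite -permM -expgD mulnS [l + _]addnC addnA.
have nE : n = k * (n %/ k) by rewrite mulnC divnK.
(* Replace [l] by [k * s], cancel [k] against the modulus, then cancel [s], which is coprime to
   [n %/ k]. *)
have lM u v : (l * u == l * v %[mod n]) = (u == v %[mod n %/ k]).
  have lu w : l * w = k * (s * w) %[mod n].
    by rewrite -modnMml eql modnMml -mulnA mulnCA.
  rewrite !lu {1 2}nE -!muln_modr eqn_pmul2l //.
  have co_s : coprime (n %/ k) s.
    by rewrite coprime_sym; apply: coprime_dvdr co_sn; rewrite {2}nE dvdn_mull.
  wlog le_vu : u v / v <= u.
    by move=> H; case/orP: (leq_total u v) => /H // E; rewrite eq_sym E eq_sym.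
  by rewrite !eqn_mod_dvd ?leq_mul2l ?le_vu ?orbT // -mulnBr Gauss_dvdr.
have k_l : k %| l.
  by rewrite /dvdn -(modn_dvdm l k_n) eql modn_dvdm // modnMl.
split=> [/expg_porbit_eq | [-> /eqP]].
  rewrite cardx => eqE.
  have eqi : i = i'.
    apply: val_inj; have := congr1 (modn^~ k) eqE.
    have lk w : k %| l * w by apply: dvdn_mulr.
    rewrite !modn_dvdm // -modnDmr (eqP (lk j)) -[RHS]modnDmr.
    by rewrite (eqP (lk j')) !addn0 !modn_small.
  by split=> //; apply/eqP; rewrite -lM -(eqn_modDl i) eqE eqi.
by rewrite -lM -(eqn_modDl i') -cardx => /eqP/expg_porbit_eq.
Qed.

Theorem theorem1 (n : nat) (hn : 2 <= n)
    (sigma : 'S_n) (hsigma : is_cycle_of_length n sigma)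
    (k l : nat) (hk : 1 <= k) (hkl : k <= l) (hl : l < n)
    (hkn : k %| n) (hkdl : k %| l)
    (hs : exists s : nat, [/\ 1 <= s, s < n, gcdn s n = 1 & l = odot n s k]) :
  #|[set xi : 'S_n | (sigma ^+ k * xi == xi * sigma ^+ l)%g]| = pnum n k.
Proof.
have [x [cardx _]] := hsigma; have [s [_ _ co_sn lE]] := hs.
have eql : l = s * k %[mod n].
  (* The value [n] of [odot] is excluded by [l < n]. *)
  move: lE hl; rewrite /odot; case: ifP => [_ -> | _ -> _].
    by rewrite ltnn.
  by rewrite modn_mod.
have cardT : #|'I_n| = #|'I_k| * (n %/ k) by rewrite !card_ord mulnC divnK.
rewrite (card_intertwining (E := fun i j => (sigma ^+ (i + k * j))%g x)
  (E' := fun i j => (sigma ^+ (i + l * j))%g x) cardT) ?card_ord //.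
  by apply: (cycle_chart_expg (s := 1)); rewrite ?coprime1n ?mul1n.
by apply: (cycle_chart_expg (s := s)) => //; apply/eqP.
Qed.
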